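(* Let $\lambda>0$ and $0<\phi<\pi$. For all $n\ge1$ and all $x$, $$P_n^{( * )}(x,\lambda,\phi)=2\sin\phi\sum_{k=0}^{n-1}\frac{P_k^{(\lambda)}(x;\phi)\,P_{n-k-1}^{(1-\lambda)}(-x;\phi)}{n-k}.$$
   Context: For any real $\mu$ (not necessarily positive), $$P_n^{(\mu)}(x;\phi)=e^{in\phi}\sum_{k=0}^n\frac{(\mu+ix)_k(\mu-ix)_{n-k}}{k!\,(n-k)!}e^{-2ik\phi},$$ with $(\alpha)_0=1$, $(\alpha)_k=\alpha(\alpha+1)\cdots(\alpha+k-1)$ (Meixner--Pollaczek polynomials); equivalently $\sum_{n\ge0}P_n^{(\mu)}(x;\phi)t^n=(1-te^{i\phi})^{-(\mu-ix)}(1-te^{-i\phi})^{-(\mu+ix)}$. The numerator polynomials $P_n^{( * )}(x,\lambda,\phi)$ are defined by $P_0^{( * )}=0$, $P_1^{( * )}=2\sin\phi$ and, for $n\ge1$, $2[x\sin\phi+(n+\lambda)\cos\phi]P_n^{( * )}=(n+1)P_{n+1}^{( * )}+(n+2\lambda-1)P_{n-1}^{( * )}$. *)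

(* Defs.v *)
From HB Require Import structures.
From mathcomp Require Import all_boot all_order all_algebra.
From mathcomp Require Import reals trigo.
From mathcomp Require Export complex.

Set Implicit Arguments.
Unset Strict Implicit.
Unset Printing Implicit Defensive.

Import Order.TTheory GRing.Theory Num.Theory.
Local Open Scope ring_scope.
Local Open Scope complex_scope.

(* exp (i theta) for real theta *)
Definition expi (R : realType) (theta : R) : R[i] := cos theta +i* sin theta.

(* Rising factorial (a)_k = a (a + 1) ... (a + k - 1); mathcomp only has the
   falling factorial on nat. *)
Definition pochhammer (K : comNzRingType) (a : K) (k : nat) : K :=
  \prod_(j < k) (a + j%:R).

(* P_n^(mu)(x; phi), with mu an arbitrary real, evaluated at a complex x *)
Definition meixner_pollaczek (R : realType) (mu : R) (n : nat) (x : R[i])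
    (phi : R) : R[i] :=
  expi (n%:R * phi) *
  \sum_(k < n.+1)
     pochhammer (mu%:C + 'i%C * x) k * pochhammer (mu%:C - 'i%C * x) (n - k)
     / (k`!%:R * (n - k)`!%:R) * expi (- (2 * k%:R * phi)).

(* P_n^( * )(x, lambda, phi): the three-term recurrence at index n = m + 1,
   solved for P_(n+1)^( * ); see mp_numeratorS for the unsolved form. *)
Fixpoint mp_numerator (R : realType) (n : nat) (x : R[i]) (lambda phi : R)
    {struct n} : R[i] :=
  match n with
  | 0 => 0
  | m.+1 =>
    match m with
    | 0 => 2 * (sin phi)%:C
    | m'.+1 =>
      (2 * (x * (sin phi)%:C + (m%:R + lambda%:C) * (cos phi)%:C)
         * mp_numerator m x lambda phi
       - (m%:R + 2 * lambda%:C - 1) * mp_numerator m' x lambda phi)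
      / m.+1%:R
    end
  end.

Lemma mp_numerator0 (R : realType) (x : R[i]) (lambda phi : R) :
  mp_numerator 0 x lambda phi = 0.
Proof. by []. Qed.

Lemma mp_numerator1 (R : realType) (x : R[i]) (lambda phi : R) :
  mp_numerator 1 x lambda phi = 2 * (sin phi)%:C.
Proof. by []. Qed.

Lemma mp_numeratorS (R : realType) (n : nat) (x : R[i]) (lambda phi : R) :
  (1 <= n)%N ->
  2 * (x * (sin phi)%:C + (n%:R + lambda%:C) * (cos phi)%:C)
    * mp_numerator n x lambda phi
  = (n%:R + 1) * mp_numerator n.+1 x lambda phi
    + (n%:R + 2 * lambda%:C - 1) * mp_numerator n.-1 x lambda phi.
Proof.
case: n => [//|m] _.
have -> : mp_numerator m.+2 x lambda phi =
  (2 * (x * (sin phi)%:C + (m.+1%:R + lambda%:C) * (cos phi)%:C)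
     * mp_numerator m.+1 x lambda phi
   - (m.+1%:R + 2 * lambda%:C - 1) * mp_numerator m x lambda phi)
  / m.+2%:R by [].
by rewrite natr1 [X in _ = X + _]mulrC divfK ?pnatr_eq0// subrK.
Qed.

(* Main.v *)
Require Import Defs.
From mathcomp Require Import all_boot all_order all_algebra.
From mathcomp Require Import reals trigo.
From mathcomp Require Import ring.

Import Order.TTheory GRing.Theory Num.Theory.
Local Open Scope ring_scope.
Local Open Scope complex_scope.

(** Write [z = exp (i phi)], [w = exp (- i phi)], [a = lambda + i x] and
    [b = lambda - i x].  The generating function of the [P_k^(lambda)(x)] is
    [F = (1 - t w)^-a (1 - t z)^-b], that of the [P_k^(1 - lambda)(-x)] is
    [G = (1 - t w)^(a - 1) (1 - t z)^(b - 1)], so that [D F G = 1] and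
    [D F' = E F] with [D = (1 - t w) (1 - t z)] and
    [E = a w (1 - t z) + b z (1 - t w)].  If [H] is the primitive of [G] without
    constant term, then [D (F H)' = E F H + 1]; comparing coefficients, this is
    the recurrence of the numerator polynomials divided by [2 sin phi].
    Power series are represented by polynomials modulo ['X^M]. *)

Section TruncatedSeries.
Context {K : numFieldType}.
Implicit Types (a b c w z : K) (p q : {poly K}) (M : nat).

(** The explicit cofactor lets congruences be combined by rewriting and [ring]. *)
Definition eq_modX M p q := exists r, p = q + r * 'X^M.

Lemma eq_modXP M p q :
  (forall i, (i < M)%N -> p`_i = q`_i) -> eq_modX M p q.
Proof.
move=> pq; exists (drop_poly M (p - q)).
suff t0 : take_poly M (p - q) = 0.
  by rewrite -[_ * _]add0r -t0 poly_take_drop addrC subrK.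
apply/polyP => i; rewrite coef_take_poly coef0 coefB.
by case: ifP => // /pq ->; rewrite subrr.
Qed.

Lemma coef_eq_modX M p q i : eq_modX M p q -> (i < M)%N -> p`_i = q`_i.
Proof. by move=> [r ->] iM; rewrite coefD coefMXn iM addr0. Qed.

(** This is the coefficient of [t ^ i] in [(1 - t w)^-a]. *)
Definition binomial_coef a w (i : nat) : K := pochhammer a i / i`!%:R * w ^+ i.

Definition binomial_series M a w : {poly K} :=
  \poly_(i < M.+1) binomial_coef a w i.

Lemma binomial_coefS a w i :
  binomial_coef a w i.+1 * i.+1%:R = (a + i%:R) * w * binomial_coef a w i.
Proof.
rewrite /binomial_coef /pochhammer big_ord_recr /= factS natrM exprS.
have h1 : i.+1%:R != 0 :> K by rewrite pnatr_eq0.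
have h2 : i`!%:R != 0 :> K by rewrite pnatr_eq0 -lt0n fact_gt0.
by move: h1 h2; move: (i.+1%:R) (i`!%:R) => u v u0 v0; field; rewrite u0 v0.
Qed.

(** The differential equation of [(1 - t w)^-a], equivalent to the ratio of consecutive coefficients
    in [binomial_coefS]. Differentiation costs one order of precision: coefficients up to index [M]
    give a congruence modulo ['X^M]. *)
Lemma deriv_binomial_series M a w :
  eq_modX M ((1 - w *: 'X) * (binomial_series M a w)^`())
            ((a * w) *: binomial_series M a w).
Proof.
apply: eq_modXP => i iM.
rewrite mulrBl mul1r coefB -scalerAl !coefZ coefXM !coef_deriv !coef_poly.
have iM1 : (i < M.+1)%N := leqW iM.
rewrite (iM : (i.+1 < M.+1)%N) iM1 -mulr_natr binomial_coefS.
case: i iM iM1 => [|i] _ iM1 /=; first by rewrite mulr0 subr0 addr0.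
by rewrite iM1 -mulr_natr; ring.
Qed.

(** The exponents [1], [- a] and [a - 1] add up to 0, so the product has zero derivative modulo
    ['X^M]; its constant term is 1. *)
Lemma binomial_series_mul M a w :
  eq_modX M ((1 - w *: 'X) * binomial_series M a w * binomial_series M (1 - a) w) 1.
Proof.
have [r Er] := deriv_binomial_series M a w.
have [s Es] := deriv_binomial_series M (1 - a) w.
set A := binomial_series M a w in Er *.
set B := binomial_series M (1 - a) w in Es *.
have dP : ((1 - w *: 'X) * A * B)^`() = (r * B + s * A) * 'X^M.
  rewrite !derivM derivB derivZ derivX derivC.
  transitivity (- w%:P * A * B + ((1 - w *: 'X) * A^`()) * B
                + ((1 - w *: 'X) * B^`()) * A).
    by rewrite -!mul_polyC; ring.
  rewrite Er Es -!mul_polyC; rewrite !(polyCM, polyCB, polyCN); ring.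
apply: eq_modXP => -[|i] iM.
  rewrite !coef0M coefB coefZ coefX mulr0 subr0 !coef_poly /= coef1 /=.
  by rewrite /binomial_coef /pochhammer !big_ord0 fact0 !expr0; field.
(* The coefficient of index [i.+1], times [i.+1], is a coefficient of the derivative, and [i.+1] is
   nonzero in [K]. *)
have /polyP /(_ i) := dP.
rewrite coef_deriv coefMXn (ltnW iM) coef1 /= => /eqP.
by rewrite mulrn_eq0 /= => /eqP.
Qed.

Definition meixner_coef a b w z (n : nat) : K :=
  \sum_(k < n.+1) binomial_coef a w k * binomial_coef b z (n - k).

Definition meixner_series M a b w z :=
  binomial_series M a w * binomial_series M b z.

Lemma coef_meixner_series M a b w z n : (n <= M)%N ->
  (meixner_series M a b w z)`_n = meixner_coef a b w z n.
Proof.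
move=> nM; rewrite coefM; apply: eq_bigr => k _.
rewrite !coef_poly !ltnS (leq_trans (leq_subr _ _) nM).
by rewrite (leq_trans (leq_ord k) nM).
Qed.

(* The coefficients of [F H] in the notation of the header. *)
Definition numerator_coef a b w z (n : nat) : K :=
  \sum_(0 <= k < n) meixner_coef a b w z k
    * meixner_coef (1 - a) (1 - b) w z (n - k - 1) / (n - k)%:R.

Definition primitive_series M p : {poly K} := \poly_(i < M.+1) (p`_i.-1 / i%:R).

Lemma deriv_primitive_series M p : eq_modX M (primitive_series M p)^`() p.
Proof.
apply: eq_modXP => i iM.
rewrite coef_deriv coef_poly ltnS iM -[LHS]mulr_natr divfK //.
by rewrite pnatr_eq0.
Qed.

Lemma coef_numerator_series M a b w z n : (n <= M)%N ->
  (meixner_series M a b w z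
     * primitive_series M (meixner_series M (1 - a) (1 - b) w z))`_n =
  numerator_coef a b w z n.
Proof.
move=> nM; rewrite coefM big_ord_recr /= subnn.
(* the coefficient of index 0 of the primitive is the junk value p`_0 / 0 = 0 *)
rewrite [X in _ + _ * X]coef_poly /= invr0 !mulr0 addr0.
rewrite /numerator_coef big_mkord; apply: eq_bigr => k _.
have kM : (k <= M)%N by rewrite (leq_trans (ltnW (ltn_ord k)) nM).
have nkM : (n - k <= M)%N by rewrite (leq_trans (leq_subr _ _) nM).
rewrite coef_poly ltnS nkM !coef_meixner_series //.
  by rewrite subn1 mulrA.
by rewrite (leq_trans (leq_pred _) nkM).
Qed.

Lemma deriv_numerator_series M a b w z :
  let S := meixner_series M a b w z
     * primitive_series M (meixner_series M (1 - a) (1 - b) w z) in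
  eq_modX M ((1 - w *: 'X) * (1 - z *: 'X) * S^`())
    ((((a * w) *: (1 - z *: 'X) + (b * z) *: (1 - w *: 'X)) * S) + 1).
Proof.
rewrite /= /meixner_series.
have [r1 e1] := deriv_binomial_series M a w.
have [r2 e2] := deriv_binomial_series M b z.
have [r4 e4] := binomial_series_mul M a w.
have [r5 e5] := binomial_series_mul M b z.
set A := binomial_series M a w in e1 e4 *.
set B := binomial_series M b z in e2 e5 *.
set A' := binomial_series M (1 - a) w in e4 *.
set B' := binomial_series M (1 - b) z in e5 *.
have [r3] := deriv_primitive_series M (A' * B').
set H := primitive_series M _ => e3.
set u := 1 - w *: 'X in e1 e4 *; set v := 1 - z *: 'X in e2 e5 *.
set Y : {poly K} := 'X^M in e1 e2 e3 e4 e5 *.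
rewrite /eq_modX -/Y !derivM e3.
(* The first three terms are the errors in [A^]()[,]B^[()] and the derivative of [H]; the others
   come from [(1 + r4 * Y) * (1 + r5 * Y) - 1]. *)
exists (r1 * B * v * H + r2 * A * u * H + u * v * A * B * r3
        + r4 + r5 + r4 * r5 * Y).
transitivity ((u * A^`()) * B * v * H + (v * B^`()) * A * u * H
  + (u * A * A') * (v * B * B') + u * v * A * B * r3 * Y); first by ring.
by rewrite e1 e2 e4 e5 -!mul_polyC; ring.
Qed.

Lemma numerator_coef0 a b w z : numerator_coef a b w z 0 = 0.
Proof. exact: big_geq. Qed.

Lemma numerator_coef1 a b w z : numerator_coef a b w z 1 = 1.
Proof.
rewrite /numerator_coef big_nat1 /meixner_coef !big_ord1 /binomial_coef.
by rewrite /pochhammer !big_ord0 fact0 /= !expr0 !(divr1, mulr1).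
Qed.

(** Comparison of the coefficients of index [m.+1] in the differential equation of [F H]. *)
Lemma numerator_coefS a b w z m :
  m.+2%:R * numerator_coef a b w z m.+2 =
  (a * w + b * z + m.+1%:R * (w + z)) * numerator_coef a b w z m.+1
  - (a + b + m%:R) * (w * z) * numerator_coef a b w z m.
Proof.
(* The order [m.+2] suffices: the derivative at index [m.+1] involves [S] up to index [m.+2]. *)
have /coef_eq_modX /(_ (ltnSn m.+1)) := deriv_numerator_series m.+2 a b w z.
set S := _ * primitive_series _ _.
have SE n : (n <= m.+2)%N -> S`_n = numerator_coef a b w z n.
  exact: coef_numerator_series.
have -> : (1 - w *: 'X) * (1 - z *: 'X) * S^`() =
    S^`() - (w + z) *: ('X * S^`()) + (w * z) *: ('X * ('X * S^`())).
  by rewrite -!mul_polyC !(polyCM, polyCD); ring.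
have -> : ((a * w) *: (1 - z *: 'X) + (b * z) *: (1 - w *: 'X)) * S =
    (a * w + b * z) *: S - ((a + b) * (w * z)) *: ('X * S).
  by rewrite -!mul_polyC !(polyCM, polyCD); ring.
(* For [m = 0] the shift leaves no coefficient of the derivative, in agreement with the factor
   [m]. *)
have XX : ('X * ('X * S^`()))`_m.+1 = S`_m *+ m.
  by rewrite !coefXM /=; case: (m) => // k; rewrite coef_deriv.
rewrite !(coefD, coefN, coefZ, XX, coefXM, coef_deriv, coef1) /=.
rewrite !SE ?leqnSn ?(leqW (leqnSn m)) //.
move: (numerator_coef _ _ _ _ m.+2) (numerator_coef _ _ _ _ m.+1).
move: (numerator_coef _ _ _ _ m) => s0 s2 s1 /eqP; rewrite -subr_eq0 => /eqP e.
by apply/eqP; rewrite -subr_eq0; apply/eqP; rewrite -[RHS]e; ring.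
Qed.

End TruncatedSeries.

Lemma expiD (R : realType) (s t : R) : expi (s + t) = expi s * expi t.
Proof.
rewrite /expi cosD sinD; apply/eqP; rewrite eq_complex /= eqxx /=.
by apply/eqP; ring.
Qed.

Lemma expi0 (R : realType) : expi (0 : R) = 1.
Proof. by rewrite /expi cos0 sin0. Qed.

Lemma expi_natM (R : realType) (n : nat) (t : R) : expi (n%:R * t) = expi t ^+ n.
Proof.
elim: n => [|n IH]; first by rewrite mul0r expi0.
by rewrite -natr1 mulrDl mul1r expiD IH exprSr.
Qed.

Lemma expiNM (R : realType) (t : R) : expi (- t) * expi t = 1.
Proof. by rewrite -expiD addNr expi0. Qed.

Lemma expiND (R : realType) (t : R) : expi (- t) + expi t = 2 * (cos t)%:C.
Proof.
rewrite /expi cosN sinN; apply/eqP; rewrite eq_complex /=.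
by apply/andP; split; apply/eqP; ring.
Qed.

Lemma expiNB (R : realType) (t : R) :
  'i%C * (expi (- t) - expi t) = 2 * (sin t)%:C.
Proof.
rewrite /expi cosN sinN; apply/eqP; rewrite eq_complex /=.
by apply/andP; split; apply/eqP; ring.
Qed.

(** Since [n - 2 k = (n - k) - k], the two exponential factors merge into
    [w ^+ k * z ^+ (n - k)]. *)
Lemma meixner_pollaczekE (R : realType) (mu : R) (n : nat) (x : R[i]) (phi : R) :
  meixner_pollaczek mu n x phi =
  meixner_coef (mu%:C + 'i%C * x) (mu%:C - 'i%C * x) (expi (- phi)) (expi phi) n.
Proof.
rewrite /meixner_pollaczek mulr_sumr; apply: eq_bigr => k _.
have -> : - (2 * k%:R * phi) = (k + k)%:R * - phi.
  by rewrite natrD; ring.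
rewrite !expi_natM /binomial_coef.
have e : expi phi ^+ n * expi (- phi) ^+ (k + k) =
    expi (- phi) ^+ k * expi phi ^+ (n - k).
  rewrite -{1}(subnK (leq_ord k)) !exprD.
  transitivity ((expi (- phi) * expi phi) ^+ k * expi (- phi) ^+ k
                * expi phi ^+ (n - k)); first by rewrite exprMn; ring.
  by rewrite expiNM expr1n mul1r.
rewrite invfM mulrCA e; ring.
Qed.

Lemma mp_numeratorE (R : realType) (lambda phi : R) (n : nat) (x : R[i]) :
  mp_numerator n x lambda phi =
  2 * (sin phi)%:C *
  numerator_coef (lambda%:C + 'i%C * x) (lambda%:C - 'i%C * x)
    (expi (- phi)) (expi phi) n.
Proof.
set a := lambda%:C + _; set b := lambda%:C - _.
(* The recurrence has order two, so the induction carries two consecutive values. *)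
suff [] : mp_numerator n x lambda phi = 2 * (sin phi)%:C *
            numerator_coef a b (expi (- phi)) (expi phi) n /\
          mp_numerator n.+1 x lambda phi = 2 * (sin phi)%:C *
            numerator_coef a b (expi (- phi)) (expi phi) n.+1 by [].
elim: n => [|n [IH0 IH1]].
  by rewrite numerator_coef0 numerator_coef1 mulr0 mulr1.
split=> //.
have n2 : n.+2%:R != 0 :> R[i] by rewrite pnatr_eq0.
apply: (mulfI n2); rewrite [RHS]mulrCA numerator_coefS expiNM expiND.
(* With [w z = 1] and [w + z = 2 cos phi], this value of [a w + b z] turns [numerator_coefS] into
   the defining recurrence. *)
have -> : a * expi (- phi) + b * expi phi =
    2 * lambda%:C * (cos phi)%:C + 2 * (sin phi)%:C * x.
  rewrite -expiNB; transitivity (lambda%:C * (expi (- phi) + expi phi)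
    + 'i%C * (expi (- phi) - expi phi) * x); first by rewrite /a /b; ring.
  by rewrite expiND; ring.
have -> : n.+2%:R * mp_numerator n.+2 x lambda phi =
    2 * (x * (sin phi)%:C + (n.+1%:R + lambda%:C) * (cos phi)%:C)
      * mp_numerator n.+1 x lambda phi
    - (n.+1%:R + 2 * lambda%:C - 1) * mp_numerator n x lambda phi.
  by rewrite mp_numeratorS //= natr1 addrK.
by rewrite IH0 IH1 -natr1 /a /b; ring.
Qed.

Theorem mainTheorem9 (R : realType) (lambda phi : R)
    (lambda_gt0 : 0 < lambda) (phi_gt0 : 0 < phi) (phi_ltpi : phi < pi)
    (n : nat) (n_ge1 : (1 <= n)%N) (x : R[i]) :
  mp_numerator n x lambda phi =
  2 * (sin phi)%:C *
  \sum_(0 <= k < n)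
     meixner_pollaczek lambda k x phi
     * meixner_pollaczek (1 - lambda) (n - k - 1) (- x) phi / (n - k)%:R.
Proof.
rewrite mp_numeratorE; congr (_ * _); apply: eq_bigr => k _.
(* The parameters for [1 - lambda] at [- x] are [1 - lambda - i x = 1 - a] and
   [1 - lambda + i x = 1 - b]. *)
rewrite !meixner_pollaczekE rmorphB rmorph1; congr (_ * meixner_coef _ _ _ _ _ / _).
  by ring.
by ring.
Qed.
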